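(* Let $\alpha\in(0,2)$ and let $g$ be a probability density on $[0,\infty)$ such that $g(x)<\frac1\alpha$ almost everywhere and $\int_0^\infty x g(x)\,dx=1$. Let $G(x)=\int_0^x g(t)\,dt$ and for $\xi\in[0,1]$ define $$w(\xi)=\frac{1}{1-\alpha/2}\Big(\frac{1}{g(G^{-1}(\xi))}-\alpha\Big)(1-\xi).$$ Then $w$ is a probability density on $[0,1]$, and with $$\phi(\xi)=\Big(1-\frac\alpha2\Big)\int_0^\xi\frac{w(t)}{1-t}\,dt+\alpha\xi$$ one has $g(x)=\frac{1}{\phi'(\phi^{-1}(x))}$ and $$\frac{\alpha g(x)}{1-\alpha g(x)}=\frac{2\alpha}{2-\alpha}\,\frac{1-\phi^{-1}(x)}{w(\phi^{-1}(x))}.$$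
   Formalization: It is also assumed that g>0 almost everywhere where G<1 (else w need not integrate to 1, e.g. g=1 on [0,1/2]∪[3/2,2], α<1), and the two identities are stated for almost every x≥0 with G(x)<1. *)

(* Defs.v *)
From HB Require Import structures.
From mathcomp Require Import all_boot all_order all_algebra.
From mathcomp Require Import all_classical all_reals all_analysis.
Set Implicit Arguments. Unset Strict Implicit. Unset Printing Implicit Defensive.
Import Order.TTheory GRing.Theory Num.Theory.
Import numFieldNormedType.Exports.
Local Open Scope classical_set_scope.
Local Open Scope ring_scope.

Section Defs.
Variable R : realType.
Notation mu := (@lebesgue_measure R).

Definition Gcdf (g : R -> R) (x : R) : R :=
  fine (\int[mu]_(t in `[0, x]) (g t)%:E).

(* G^{-1}(xi) : the (generalized) inverse of G on [0,oo);
   under the hypotheses of the theorem it is the genuine inverse on [0,1). *)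
Definition Ginv (g : R -> R) (xi : R) : R :=
  inf [set x : R | 0 <= x /\ xi <= Gcdf g x].

Definition wfun (a : R) (g : R -> R) (xi : R) : R :=
  (1 - a / 2)^-1 * ((g (Ginv g xi))^-1 - a) * (1 - xi).

Definition phifun (a : R) (g : R -> R) (xi : R) : R :=
  (1 - a / 2) * fine (\int[mu]_(t in `[0, xi]) (wfun a g t / (1 - t))%:E)
  + a * xi.

End Defs.

(* Main.v *)
Require Import Defs.
From HB Require Import structures.
From mathcomp Require Import all_boot all_order all_algebra.
From mathcomp Require Import all_classical all_reals all_analysis.
From mathcomp Require Import measurable_realfun ring lra.
Import Order.TTheory GRing.Theory Num.Theory.
Import numFieldNormedType.Exports.
Local Open Scope classical_set_scope.
Local Open Scope ring_scope.

(**
Probability integral transform: the cdf [G] pushes [g(x) dx] forward to the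
uniform law on [[0, 1]], so that the integral of [h(t)] over [[0, 1]] is that
of [h(G x) g(x)] over [[0, +oo)].  Since [g > 0] almost everywhere where
[G < 1], [G] is strictly increasing there and [Ginv] is its inverse.  Taking
[h = 1 / (g o Ginv)] on [[0, xi]] turns the integral defining [phi] into
[Ginv xi - a xi], whence [phi = Ginv] on [[0, 1)]; taking
[h(t) = (1 - t) / g(Ginv t)] turns the integral of [w] into that of the tail
[1 - G], i.e. into the mean.  Finally [G' = g] almost everywhere by Lebesgue
differentiation, and the inverse function rule gives [phi'].
*)

(** * Measurability of inversion; facts on probabilities of rays *)

Lemma measurable_inv (R : realType) : measurable_fun setT (@GRing.inv R).
Proof.
(* Inversion is continuous on the open set of nonzero reals; the point 0 is a measurable piece of
   its own. *)
rewrite -(setUv [set 0 : R]) setUC measurable_funU//; last exact: measurableC.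
split; last exact: measurable_fun_set1.
apply: open_continuous_measurable_fun.
  by rewrite openC; exact: closed_eq.
by move=> x /[!inE]/= /eqP x0; exact: inv_continuous.
Qed.

Lemma uniform_prob_lt {R : realType} {t : R} : 0 < t < 1 ->
  uniform_prob (@ltr01 R) `]-oo, t[ = t%:E.
Proof.
move=> /andP[t0 t1]; rewrite /uniform_prob integral_uniform_pdf.
rewrite (_ : _ `&` _ = `[0, t[%classic); last first.
  apply/seteqP; split => x /=; rewrite !in_itv/=.
    by move=> [-> /andP[->]].
  by move=> /andP[-> xt]; split => //; rewrite ltW// (lt_trans xt).
transitivity (\int[lebesgue_measure]_(x in `[0%R, t[) (1 : \bar R))%E.
  apply: eq_integral => x; rewrite inE /= in_itv/= => /andP[x0 xt].
  by rewrite /uniform_pdf x0 (ltW (lt_trans xt t1)) subr0 invr1.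
by rewrite integral_cst//= mul1e lebesgue_measure_itv/= lte_fin t0 sube0.
Qed.

(** Letting [t] tend to 1 closes the gap; this settles the rays []-oo, t[] with [t >= 1] from those
    with [t < 1]. *)
Lemma probability_eq1 {d} {T : measurableType d} {R : realType}
    (P : probability T R) (A : set T) : measurable A ->
  (forall t, 0 < t < 1 -> (t%:E <= P A)%E) -> P A = 1%E.
Proof.
move=> mA PA; apply/eqP; rewrite eq_le probability_le1//=.
apply/lee_subgt0Pr => e e0; have [e1|e1] := ltP e 1.
  by apply: PA; rewrite subr_gt0 e1 gtrBl e0.
by apply: le_trans (measure_ge0 P A); rewrite -EFinB lee_fin subr_le0.
Qed.

(** * Probability measures given by a density *)

Section density.
Set Implicit Arguments.
Unset Strict Implicit.
Local Open Scope ereal_scope.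
Context d (T : measurableType d) (R : realType).
Variables (mu : {sigma_finite_measure set T -> \bar R}) (f : T -> R).

Definition density_prob (mf : measurable_fun setT f)
    (f0 : forall x, (0 <= f x)%R)
    (f1 : \int[mu]_x (f x)%:E = 1) (A : set T) : \bar R :=
  \int[mu]_(x in A) (f x)%:E.

Variables (mf : measurable_fun setT f) (f0 : forall x, (0 <= f x)%R)
  (f1 : \int[mu]_x (f x)%:E = 1).
Notation nu := (density_prob mf f0 f1).

Let density0 : nu set0 = 0.
Proof. exact: integral_set0. Qed.

Let density_ge0 A : 0 <= nu A.
Proof. by apply: integral_ge0 => x _; rewrite lee_fin. Qed.

Let density_sigma_additive : semi_sigma_additive nu.
Proof.
move=> /= F mF tF mUF; rewrite /density_prob; apply: cvg_toP.
  apply: ereal_nondecreasing_is_cvgn => m n mn.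
  apply: lee_sum_nneg_natr => // k _ _.
  by apply: integral_ge0 => /= x _; rewrite lee_fin.
rewrite ge0_integral_bigcup//=.
- exact/measurable_EFinP/measurable_funTS.
- by move=> x _; rewrite lee_fin.
Qed.

HB.instance Definition _ := isMeasure.Build _ _ _ nu
  density0 density_ge0 density_sigma_additive.

Let density_setT : nu setT = 1.
Proof. exact: f1. Qed.

HB.instance Definition _ := @Measure_isProbability.Build _ _ R nu density_setT.

Lemma integrable_density : mu.-integrable setT (EFin \o f).
Proof.
apply/integrableP; split; first exact/measurable_EFinP.
under eq_integral do rewrite /= ger0_norm//.
by rewrite f1 ltry.
Qed.

(** The Radon-Nikodym change of variables applies because [nu] is dominated by [mu]; it remains to
    identify the abstract derivative with [f]. *)
Lemma ge0_integral_density (h : T -> \bar R) :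
  measurable_fun setT h -> (forall x, 0 <= h x) ->
  \int[nu]_x h x = \int[mu]_x (h x * (f x)%:E).
Proof.
move=> mh h0.
have dom : nu `<< mu.
  apply/null_content_dominatesP => A mA A0.
  apply: null_set_integral => //.
  exact/measurable_EFinP/measurable_funTS.
rewrite -(Radon_Nikodym_SigmaFinite.change_of_variables dom)//.
apply: ge0_ae_eq_integral => //.
- apply: emeasurable_funM => //.
  exact: measurable_int (Radon_Nikodym_SigmaFinite.f_integrable dom).
- by apply: emeasurable_funM => //; exact/measurable_EFinP.
- by move=> x _; rewrite mule_ge0// Radon_Nikodym_SigmaFinite.f_ge0.
- by move=> x _; rewrite mule_ge0// lee_fin.
(* Both functions have integral [nu E] over every measurable [E], hence agree almost everywhere. *)
- apply: ae_eqe_mul2l; apply: integral_ae_eq => //.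
  + exact: Radon_Nikodym_SigmaFinite.f_integrable.
  + exact/measurable_EFinP.
  + by move=> E _ mE; rewrite -Radon_Nikodym_SigmaFinite.f_integral.
Qed.

End density.

(** * The distribution function of a density on the half-line *)

Section cdf_of_density.
Set Implicit Arguments.
Unset Strict Implicit.
Variables (R : realType) (g : R -> R).
Notation mu := (@lebesgue_measure R).
Hypotheses (g_meas : measurable_fun (`[0, +oo[ : set R) g)
  (g_ge0 : forall x, 0 <= x -> 0 <= g x)
  (g_int1 : (\int[mu]_(x in `[0%R, +oo[) (g x)%:E = 1)%E).
(** Nothing is assumed of [g] at negative arguments; extension by zero gives a genuine density on
    the whole line. *)
Let f := g \_ `[0, +oo[.
Notation G := (Gcdf g).

Lemma density_meas : measurable_fun setT f.
Proof. by apply/(measurable_restrictT _ _).1. Qed.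

Lemma density_ge0 x : 0 <= f x.
Proof.
by apply: restrict_ge0 => y /=; rewrite in_itv/= andbT; exact: g_ge0.
Qed.

Lemma integral_density (A : set R) :
  (\int[mu]_(x in A) (f x)%:E = \int[mu]_(x in A `&` `[0%R, +oo[) (g x)%:E)%E.
Proof.
rewrite integral_mkcondr; apply: eq_integral => x _.
by rewrite /f !patchE; case: ifP.
Qed.

Lemma density_int1 : (\int[mu]_x (f x)%:E = 1)%E.
Proof. by rewrite integral_density setTI. Qed.

Notation nu := (@density_prob _ (measurableTypeR R) R mu f
  density_meas density_ge0 density_int1).

Let intf : mu.-integrable setT (EFin \o f) :=
  @integrable_density _ (measurableTypeR R) R mu f density_meas density_ge0
    density_int1.

Lemma GcdfE x : (G x)%:E = nu `]-oo, x].
Proof.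
rewrite /Gcdf fineK; last first.
  rewrite -[`[0, x]%classic](_ : (`]-oo, x] `&` `[0, +oo[)%classic = _).
    rewrite -integral_density.
    by apply: integrable_fin_num => //; exact: integrableS intf.
  by apply/seteqP; split => y /=; rewrite !in_itv/= ?andbT;
    [move=> [-> ->]|move=> /andP[]].
rewrite /density_prob integral_density; congr (integral _ _ _).
by apply/seteqP; split => y /=; rewrite !in_itv/= ?andbT;
  [move=> /andP[]|move=> [-> ->]].
Qed.

(** Since [f] vanishes on the negative half-line, the lower endpoint is free; a very negative [m]
    makes any given point interior, as continuity of [G] there demands. *)
Lemma Gcdf_itv (m x : R) : m <= 0 -> G x = \int[mu]_(t in `[m, x]) f t.
Proof.
move=> m0; congr fine; rewrite integral_density; congr (integral _ _ _).
apply/seteqP; split => y /=; rewrite !in_itv/= ?andbT.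
  by move=> /andP[y0 ->]; rewrite y0 (le_trans m0).
by move=> [/andP[_ ->] ->].
Qed.

Lemma Gcdf_continuous : continuous G.
Proof.
move=> x; pose M := `|x| + 1.
have M0 : 0 < M by rewrite ltr_pwDr.
have intM : mu.-integrable `[- M, M] (EFin \o f) by exact: integrableS intf.
have NMM : - M < M by rewrite gtrN.
have := parameterized_integral_continuous (ltW NMM) intM.
rewrite (_ : (fun _ => _) = G); last first.
  by apply/funext => y; rewrite (@Gcdf_itv (- M))// oppr_le0 ltW.
move=> /(continuous_within_itvP _ NMM)[+ _ _]; apply.
by rewrite in_itv/= -ltr_norml ltrDl.
Qed.

Lemma Gcdf_le x y : x <= y -> G x <= G y.
Proof.
move=> xy; rewrite -lee_fin !GcdfE; apply: le_measure; rewrite ?inE//.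
exact: subset_itvl.
Qed.

Lemma Gcdf_ge0 x : 0 <= G x.
Proof. by rewrite -lee_fin GcdfE. Qed.

Lemma Gcdf_le1 x : G x <= 1.
Proof. by rewrite -lee_fin GcdfE probability_le1. Qed.

Lemma Gcdf_le0 x : x <= 0 -> G x = 0.
Proof.
rewrite le_eqVlt => /predU1P[->|x0].
  by rewrite /Gcdf set_itv1 integral_set1.
by rewrite /Gcdf set_itv_ge ?integral_set0// bnd_simp -ltNge.
Qed.

(** The identity as a random variable under [nu]: its distribution function is [G], whose limit at
    infinity is therefore 1. *)
Let idTR : measurableTypeR R -> R := idfun.

#[local] HB.instance Definition _ :=
  @isMeasurableFun.Build _ _ _ _ idTR (@measurable_id _ _ setT).

Lemma Gcdf_gt (t : R) : t < 1 -> exists2 x, 0 <= x & t < G x.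
Proof.
move=> t1.
have Xcvg : G x @[x --> +oo] --> (1 : R).
  rewrite (_ : Gcdf g = fine \o cdf (idTR : {RV nu >-> R})); last first.
    by apply/funext => x; rewrite -[LHS]/(fine (G x)%:E) GcdfE.
  exact/fine_cvg/cvg_cdfy1.
have : \forall x \near +oo, 0 <= x /\ t < G x.
  near=> x; split; first by near: x; exact: nbhs_pinfty_ge.
  by near: x; exact: cvgr_gt t1.
by case/filter_ex => x [x0 tx]; exists x.
Unshelve. all: by end_near. Qed.

Lemma Gcdf_surj (t : R) : 0 <= t < 1 -> exists2 x, 0 <= x & G x = t.
Proof.
move=> /andP[t0 t1]; have [y y0 ty] := Gcdf_gt t1.
have [||x] := @IVT R G 0 y t y0.
- exact/continuous_subspaceT/Gcdf_continuous.
- rewrite (Gcdf_le0 (lexx 0)) min_l ?Gcdf_ge0// max_r ?Gcdf_ge0//.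
  by rewrite t0 ltW.
- by rewrite in_itv/= => /andP[x0 _] <-; exists x.
Qed.

(** * The quantile function as a generalized inverse *)

Notation S t := [set x | 0 <= x /\ t <= G x].

Lemma Ginv_ge0 t : 0 <= Ginv g t.
Proof.
(* [S t] may be empty when [t >= 1]; the infimum then takes the default value 0. *)
rewrite /Ginv; have [->|/set0P S0] := eqVneq (S t) set0; first by rewrite inf0.
by apply: lb_le_inf => // x [].
Qed.

Let has_inf_S t : 0 <= t < 1 -> has_inf (S t).
Proof.
move=> t01; have [x x0 Gx] := Gcdf_surj t01; split.
  by exists x; rewrite /= Gx.
by exists 0 => y [].
Qed.

Let Ginv_lb t x : 0 <= x -> t <= G x -> Ginv g t <= x.
Proof. by move=> x0 tx; apply: ge_inf => //; exists 0 => y []. Qed.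

Lemma GinvK t : 0 <= t < 1 -> G (Ginv g t) = t.
Proof.
move=> t01; apply/eqP; rewrite eq_le; apply/andP; split.
  have [x x0 Gx] := Gcdf_surj t01.
  by rewrite -[leRHS]Gx Gcdf_le// Ginv_lb// Gx.
(* If [G] were below [t] at the infimum, it would be so on a neighbourhood by continuity, yet points
   of [S t] lie arbitrarily close. *)
rewrite leNgt; apply/negP => Gt.
have /nbhs_ballP[e /= e0 eG] : \forall x \near Ginv g t, G x < t.
  exact: (cvgr_lt _ (@Gcdf_continuous (Ginv g t))) Gt.
have [x [x0 tx] xlt] := inf_adherent e0 (has_inf_S t01).
have := Ginv_lb x0 tx => xge.
suff : G x < t by rewrite ltNge tx.
by apply: eG; rewrite /ball/= ler0_norm ?subr_le0// opprB ltrBlDl.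
Qed.

Lemma Ginv_le t x : 0 <= t < 1 -> 0 <= x -> (Ginv g t <= x) = (t <= G x).
Proof.
move=> t01 x0; apply/idP/idP => [|/Ginv_lb]; last exact.
by move=> /Gcdf_le; rewrite GinvK.
Qed.

Lemma Ginv_lt t x : 0 <= t < 1 -> 0 <= x -> (x < Ginv g t) = (G x < t).
Proof. by move=> t01 x0; rewrite !ltNge Ginv_le. Qed.

(** * The probability integral transform *)

Lemma Gcdf_meas : measurable_fun setT G.
Proof. exact: continuous_measurable_fun Gcdf_continuous. Qed.

(** The preimage is the open ray below [Ginv g t]; its endpoint carries no mass, so its measure is
    [G (Ginv g t)]. *)
Lemma density_Gcdf_lt (t : R) : 0 < t < 1 -> nu (G @^-1` `]-oo, t[) = t%:E.
Proof.
move=> /andP[t0 t1]; have t01 : 0 <= t < 1 by rewrite t1 ltW.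
rewrite (_ : _ @^-1` _ = `]-oo, (Ginv g t)[%classic); last first.
  apply/seteqP; split => x /=; rewrite !in_itv/=; have [x0|x0] := leP 0 x.
  - by rewrite Ginv_lt.
  - by move=> _; rewrite (lt_le_trans x0) ?Ginv_ge0.
  - by rewrite Ginv_lt.
  - by rewrite Gcdf_le0// ltW.
rewrite -[in RHS](GinvK t01) GcdfE /= /density_prob.
apply: integral_itv_bndo_bndc.
apply/measurable_EFinP/measurable_funTS; exact: density_meas.
Qed.

Let mGpre A : measurable A -> measurable (G @^-1` A).
Proof. by move=> mA; rewrite -[_ @^-1` _]setTI; exact: Gcdf_meas. Qed.

Let idG : measurableTypeR R -> measurableTypeR R := G.

#[local] HB.instance Definition _ :=
  @isMeasurableFun.Build _ _ _ _ idG Gcdf_meas.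

(** Two finite measures that agree on the open rays []-oo, t[], a generating family stable under
    intersection, are equal. The comparison splits into [t <= 0], [0 < t < 1] and [t >= 1]. *)
Lemma distribution_Gcdf (A : set R) : measurable A ->
  distribution nu (idG : {RV nu >-> measurableTypeR R}) A =
  uniform_prob (@ltr01 R) A.
Proof.
move=> mA.
have := @measure_unique _ R (measurableTypeR R) (@RGenInftyO.G R)
  (fun n => `]-oo, n%:R[%classic) _ _ _ _
  (distribution nu (idG : {RV nu >-> measurableTypeR R}))
  (uniform_prob (@ltr01 R)) _ _ A; apply.
- exact: RGenInftyO.measurableE.
- move=> _ _ [x ->] [y ->]; exists (Num.min x y).
  by apply/seteqP; split => z /=; rewrite !in_itv/= lt_min => /andP.
- by move=> n; exists n%:R.
- rewrite -subTset => x _; exists (Num.truncn x).+1 => //=.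
  by rewrite in_itv/= truncnS_gt.
- move=> _ [t ->].
  have [t0|t0] := leP t 0.
    transitivity (0%E : \bar R); [|apply/esym].
      rewrite -[LHS]/(nu (G @^-1` `]-oo, t[))
        (_ : _ @^-1` _ = set0) ?measure0//.
      apply/seteqP; split => // x /=; rewrite in_itv/= => /lt_le_trans/(_ t0).
      by rewrite ltNge Gcdf_ge0.
    rewrite -[LHS]/(\int[mu]_(x in _) (uniform_pdf 0 1 x)%:E)%E.
    rewrite integral_uniform_pdf (_ : _ `&` _ = set0).
      by rewrite integral_set0.
    apply/seteqP; split => // x []/=; rewrite !in_itv/= => /lt_le_trans/(_ t0).
    by rewrite ltNge => /negbTE ->.
  have [t1|t1] := ltP t 1.
    transitivity t%:E; [apply: density_Gcdf_lt|apply/esym/uniform_prob_lt];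
      by rewrite t0.
  transitivity (1%E : \bar R); [|apply/esym];
      apply: probability_eq1 => // s /[dup] s01 /andP[_ s1].
    rewrite -[leLHS](density_Gcdf_lt s01).
    apply: le_measure; rewrite ?inE; [exact: mGpre|exact: mGpre|].
    move=> x /=; rewrite !in_itv/= => /lt_le_trans; apply.
    by rewrite (le_trans (ltW s1)).
  rewrite -[leLHS](uniform_prob_lt s01).
  apply: le_measure; rewrite ?inE//; apply: subset_itvl.
  by rewrite bnd_simp (le_trans (ltW s1)).
- by move=> n; rewrite (le_lt_trans (probability_le1 _ _)) ?ltry.
- exact: mA.
Qed.

Let meas_comp_Gcdf (h : R -> \bar R) : measurable_fun setT h ->
  measurable_fun (`[0, +oo[ : set R) (fun x => (h (G x) * (g x)%:E)%E).
Proof.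
move=> mh; apply: emeasurable_funM; last exact/measurable_EFinP.
by apply: measurable_funTS; exact: (measurableT_comp mh Gcdf_meas).
Qed.

Lemma Gcdf_change_of_variables (h : R -> \bar R) :
  measurable_fun setT h -> (forall t, 0 <= h t)%E ->
  (\int[mu]_(t in `[0%R, 1%R]) h t =
    \int[mu]_(x in `[0%R, +oo[) (h (G x) * (g x)%:E))%E.
Proof.
move=> mh h0.
transitivity (\int[uniform_prob (@ltr01 R)]_t h t)%E.
  by rewrite integral_uniform// subr0 invr1 mul1e.
transitivity
    (\int[distribution nu (idG : {RV nu >-> measurableTypeR R})]_t h t)%E.
  apply: eq_measure_integral => A mA _; apply/esym.
  exact: distribution_Gcdf.
rewrite ge0_integral_distribution// ge0_integral_density//; last 2 first.
- exact: (measurableT_comp mh Gcdf_meas).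
- by move=> x; exact: h0.
rewrite [RHS]integral_mkcond; apply: eq_integral => x _ /=.
by rewrite /f !patchE; case: ifP => // _; rewrite mule0.
Qed.

(** * Strict monotonicity of [G] and the genuine inverse *)

Hypothesis g_pos : {ae mu, forall x, 0 <= x -> G x < 1 -> 0 < g x}.

(** On a flat piece []x, y]] the density would vanish almost everywhere, although [G] stays below 1
    there and so [g > 0] almost everywhere; the interval would be Lebesgue null. *)
Lemma Gcdf_lt x y : 0 <= x -> x < y -> G x < 1 -> G x < G y.
Proof.
move=> x0 xy Gx1; rewrite lt_neqAle Gcdf_le ?ltW// andbT.
apply/negP => /eqP Gxy.
have mf : measurable_fun `]x, y] (EFin \o f).
  by apply/measurable_EFinP/measurable_funTS; exact: density_meas.
have nu0 : nu `]x, y] = 0%E.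
  have : ((G x)%:E + nu `]x, y] = (G x)%:E)%E.
    rewrite GcdfE -measureU//; last first.
      apply/seteqP; split => // z []/=; rewrite !in_itv/= => zx /andP[].
      by rewrite ltNge zx.
    rewrite -GcdfE [in RHS]Gxy GcdfE; congr (nu _).
    apply/seteqP; split => z /=; rewrite !in_itv/=.
      by move=> [zx|/andP[]//]; rewrite (le_trans zx)// ltW.
    by move=> ->; rewrite andbT; have [] := leP z x; [left|right].
  have : nu `]x, y] \is a fin_num by rewrite fin_num_measure.
  move: (nu _) => [r||]//= _ [] /eqP.
  by rewrite eq_sym addrC -subr_eq subrr => /eqP <-.
have f0 : ae_eq mu (`]x, y]%classic : set R) (EFin \o f) (cst 0%E).
  apply/ae_eq_integral_abs => //; rewrite -[RHS]nu0.
  by apply: eq_integral => z _ /=; rewrite ger0_norm// density_ge0.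
have : {ae mu, forall z, ~ `]x, y]%classic z}.
  apply: filterS2 f0 g_pos => z fz gz zxy; move: (zxy) (fz zxy) => /=.
  rewrite in_itv/= => /andP[xz zy] [fz0].
  have z0 : 0 <= z by rewrite (le_trans x0)// ltW.
  have Gz1 : G z < 1 by rewrite (le_lt_trans (Gcdf_le zy))// -Gxy.
  have fgz : f z = g z by rewrite /f patchE mem_set//= in_itv/= z0.
  by have := gz z0 Gz1; rewrite -fgz fz0 ltxx.
move=> xyN; have : mu `]x, y] = 0%E.
  by apply: measure_negligible => //; apply: negligibleS xyN => z zxy; apply.
rewrite lebesgue_measure_itv/= lte_fin xy => /eqP.
by rewrite -EFinB eqe subr_eq0 gt_eqF.
Qed.

Lemma GcdfK x : 0 <= x -> G x < 1 -> Ginv g (G x) = x.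
Proof.
move=> x0 Gx1; have Gx01 : 0 <= G x < 1 by rewrite Gcdf_ge0.
apply/eqP; rewrite eq_le Ginv_le// lexx/= leNgt; apply/negP => /Gcdf_lt.
by rewrite GinvK// ltxx => /(_ (Ginv_ge0 _) Gx1).
Qed.

Lemma le_Ginv t x : 0 <= t < 1 -> 0 <= x -> (x <= Ginv g t) = (G x <= t).
Proof.
move=> t01 x0; apply/idP/idP => [/Gcdf_le|]; first by rewrite GinvK.
rewrite !leNgt; apply: contra => /Gcdf_lt; rewrite GinvK//; apply.
  exact: Ginv_ge0.
by case/andP : t01.
Qed.

Lemma Ginv_homo s t : 0 <= s -> s <= t -> t < 1 -> Ginv g s <= Ginv g t.
Proof.
move=> s0 st t1; have s01 : 0 <= s < 1 by rewrite s0 (le_lt_trans st).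
rewrite Ginv_le ?Ginv_ge0// GinvK// (le_trans s0 st).
exact: t1.
Qed.

(** Monotonicity makes the preimage of a ray an interval. *)
Lemma Ginv_meas : measurable_fun (`[0, 1[ : set R) (Ginv g).
Proof.
move=> mD; apply: (measurability (@RGenCInfty.G R)) => //.
  exact: RGenCInfty.measurableE.
move=> /= _ [_ [r ->]] <-; apply: is_interval_measurable => s t/=.
rewrite !in_itv/= !andbT => -[/andP[s0 s1] rs] [/andP[t0 t1] rt] u.
move=> /andP[su ut]; have u1 := le_lt_trans ut t1.
split; rewrite /= in_itv/= ?andbT; first by rewrite u1 (le_trans s0 su).
by rewrite (le_trans rs)// Ginv_homo.
Qed.

(** Carries null sets from the variable [x] to [t = G x]: if [N] is the exceptional set, the
    Lebesgue measure of its preimage [M] under [Ginv g] is the [nu]-measure of the preimage of [M]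
    under [G], which lies in [N] up to points of density zero. *)
Lemma ae_Ginv (P : R -> Prop) :
  {ae mu, forall x, 0 <= x -> G x < 1 -> P x} ->
  {ae mu, forall t, 0 <= t < 1 -> P (Ginv g t)}.
Proof.
move=> [N [mN N0 PN]].
pose M := `[0, 1[ `&` Ginv g @^-1` N.
have mM : measurable M by exact: Ginv_meas.
have M01 : M `<=` `[0, 1]%classic.
  by move=> x [/= + _]; rewrite !in_itv/= => /andP[-> /ltW ->].
exists M; split => //.
  rewrite -(setIidl M01) -integral_indic// Gcdf_change_of_variables//;
      last first.
    exact/measurable_EFinP/measurable_indic.
  rewrite -[RHS](integral0 mu `[0%R, +oo[); apply: ge0_ae_eq_integral => //.
  - apply: (@meas_comp_Gcdf (EFin \o \1_M)).
    exact/measurable_EFinP/measurable_indic.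
  - move=> x /=; rewrite in_itv/= andbT => x0.
    by rewrite mule_ge0// lee_fin g_ge0.
  exists N; split => // x /= Nx; apply: contrapT => xN; apply: Nx.
  rewrite /= in_itv/= andbT => x0.
  rewrite indicE memNset ?mul0e// => -[]; rewrite /= in_itv/= Gcdf_ge0/= => Gx1.
  by rewrite GcdfK.
move=> t /= Pt; apply: contrapT => Mt; apply: Pt => t01.
apply: contrapT => Pt; apply: Mt; split; first by rewrite /= in_itv.
apply: PN => /=; apply: contra_not Pt; apply; first exact: Ginv_ge0.
by rewrite GinvK//; case/andP : t01.
Qed.

(** * Integrals involving the reciprocal density at the quantile *)

Lemma density_Ginv_meas : measurable_fun (`[0, 1[ : set R)
  (fun t => g (Ginv g t)).
Proof.
apply: (measurable_comp (F := `[0, +oo[ : set R)) => //; last exact: Ginv_meas.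
by move=> _ [t _ <-]; rewrite /= in_itv/= andbT Ginv_ge0.
Qed.

(** Under [t = G x] the factor [(g (Ginv g t))^-1] becomes [(g x)^-1] and cancels the density
    wherever [G x < 1]. Where [G x] reaches 1, [g x] may be zero, and the vanishing of [h] makes
    both sides 0. *)
Lemma integral_div_density_Ginv (h : R -> R) : measurable_fun setT h ->
  (forall t, 0 <= h t) -> (forall t, 1 <= t -> h t = 0) ->
  (\int[mu]_(t in `[0%R, 1%R]) ((g (Ginv g t))^-1 * h t)%:E =
   \int[mu]_(x in `[0%R, +oo[) (h (G x))%:E)%E.
Proof.
move=> mh h0 h1.
(* The change of variables asks for a function measurable on the whole line, whereas [Ginv g] is
   controlled only on [[0, 1[]. *)
pose k := (fun t => (g (Ginv g t))^-1 * h t) \_ `[0, 1[.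
have mk : measurable_fun setT k.
  apply/(measurable_restrictT _ _).1 => //; apply: measurable_funM.
    exact: (measurableT_comp (measurable_inv R) density_Ginv_meas).
  exact: measurable_funTS.
have k0 t : 0 <= k t.
  apply: restrict_ge0 => {}t _.
  by rewrite mulr_ge0// invr_ge0; exact/g_ge0/Ginv_ge0.
transitivity (\int[mu]_(t in `[0%R, 1%R]) (k t)%:E)%E.
  apply: eq_integral => t; rewrite inE/= in_itv/= => /andP[t0 t1].
  rewrite /k patchE; case: ifPn => //; rewrite notin_setE/= in_itv/= t0/=.
  by move=> /negP; rewrite -leNgt => /h1 ->; rewrite mulr0.
rewrite (Gcdf_change_of_variables (h := EFin \o k))//; last first.
  exact/measurable_EFinP.
apply: ge0_ae_eq_integral => //.
- by apply: (@meas_comp_Gcdf (EFin \o k)); exact/measurable_EFinP.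
- apply/measurable_EFinP/measurable_funTS.
  exact: (measurableT_comp mh Gcdf_meas).
- move=> x /=; rewrite in_itv/= andbT => x0.
  by apply: mule_ge0; rewrite lee_fin ?k0 ?g_ge0.
- by move=> x _; rewrite lee_fin.
move: g_pos; apply: filterS; first exact: (ae_filter_ringOfSetsType mu).
move=> x gx; rewrite /= in_itv/= andbT => x0.
rewrite -EFinM; congr EFin; rewrite /k patchE.
have [G1|G1] := ltP (G x) 1.
  rewrite mem_set/=; last by rewrite in_itv/= Gcdf_ge0.
  by rewrite GcdfK// mulrAC mulVf ?mul1r// gt_eqF// gx.
rewrite memNset/=; first by rewrite mul0r h1.
by rewrite in_itv/= ltNge G1 andbF.
Qed.

(** With [h] the indicator of [[0, xi]], the right side measures the nonnegative [x] with
    [G x <= xi], that is [[0, Ginv g xi]]. *)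
Lemma integral_inv_density_Ginv (xi : R) : 0 <= xi < 1 ->
  (\int[mu]_(t in `[0%R, xi]) (g (Ginv g t))^-1%:E = (Ginv g xi)%:E)%E.
Proof.
move=> /[dup] xi01 /andP[xi0 xi1].
transitivity (\int[mu]_(t in `[0%R, 1%R])
    ((g (Ginv g t))^-1 * \1_(`[0, xi]%classic : set R) t)%:E)%E.
  have xi_sub : (`[0, xi]%classic : set R) `<=` `[0, 1]%classic.
    by apply: subset_itvl; rewrite bnd_simp ltW.
  rewrite -[in LHS](setIidr xi_sub) integral_mkcondr; apply: eq_integral => t _.
  by rewrite patchE indicE; case: ifP => _ /=; rewrite ?mulr1 ?mulr0.
rewrite (integral_div_density_Ginv (h := \1_(`[0, xi]%classic : set R)))//;
    last first.
  move=> t t1; rewrite indicE memNset//= in_itv/=.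
  by move=> /andP[_]; rewrite leNgt (lt_le_trans xi1).
transitivity (\int[mu]_(x in `[0%R, +oo[) (\1_`[0%R, (Ginv g xi)] x)%:E)%E.
  apply: eq_integral => x; rewrite inE/= in_itv/= andbT => x0.
  congr EFin; rewrite !indicE; congr (nat_of_bool _)%:R.
  apply/idP/idP; rewrite !inE/= !in_itv/= x0 Gcdf_ge0/= le_Ginv//.
rewrite integral_indic// setIidl; last by apply: subset_itvl.
rewrite /= lebesgue_measure_itv/= lte_fin sube0.
by have := Ginv_ge0 xi; rewrite le_eqVlt => /predU1P[<-|->]; rewrite ?ltxx.
Qed.

Lemma integral_ccdf :
  (\int[mu]_(x in `[0%R, +oo[) (1 - G x)%:E =
   \int[mu]_(x in `[0%R, +oo[) (x * g x)%:E)%E.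
Proof.
(* The tail formula for the mean requires a random variable that is
   nonnegative everywhere, hence [Num.max 0] instead of the identity. *)
pose X : measurableTypeR R -> R := Num.max 0.
have mX : measurable_fun setT X by exact: measurable_maxr.
pose X' : {RV nu >-> R} := HB.pack X
  (isMeasurableFun.Build _ _ _ _ X mX).
have X0 x : 0 <= X' x by rewrite /X' /= /X le_max lexx.
transitivity (\int[mu]_(r in `[0%R, +oo[) ccdf X' r)%E.
  apply: eq_integral => r; rewrite inE/= in_itv/= andbT => r0.
  rewrite [RHS](ccdf_1_cdf X' r) EFinB; congr (_ - _)%E.
  rewrite GcdfE -[RHS]/(nu (X @^-1` `]-oo, r])); congr (nu _).
  by apply/seteqP; split => x /=; rewrite !in_itv/= /X ge_max r0.
rewrite -ge0_expectation_ccdf// expectation_def.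
rewrite ge0_integral_density//; last first.
  exact/measurable_EFinP.
rewrite [RHS]integral_mkcond; apply: eq_integral => x _.
rewrite /f !patchE; case: ifPn; rewrite ?mule0// inE/= in_itv/= andbT => x0.
by rewrite /X max_r.
Qed.

(** * The density [w] and the function [phi] *)

Section quantile_density.
Variable a : R.
Hypothesis ha : 0 < a < 2.
Hypothesis g_lt : {ae mu, forall x, 0 <= x -> g x < a^-1}.
Hypothesis g_mean : (\int[mu]_(x in `[0%R, +oo[) (x * g x)%:E = 1)%E.

Let c0 : 1 - a / 2 != 0.
Proof. by move: ha => /andP[_ a2]; lra. Qed.

Lemma wfun_meas : measurable_fun (`[0, 1] : set R) (wfun a g).
Proof.
(* A single endpoint does not affect measurability, so 1 is discarded. *)
apply/measurable_fun_itv_bndo_bndcP.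
apply: measurable_funM; last exact: measurable_funB.
apply: measurable_funM => //; apply: measurable_funB => //.
exact: (measurableT_comp (measurable_inv R) density_Ginv_meas).
Qed.

(** The bounds [0 < g < a^-1] pass to quantiles by [ae_Ginv]. Strict positivity matters, since the
    convention that 0 has inverse 0 would leave [- a] in the bracket; at [xi = 1] the factor
    [1 - xi] vanishes. *)
Lemma wfun_ge0 : {ae mu, forall xi, 0 <= xi <= 1 -> 0 <= wfun a g xi}.
Proof.
have : {ae mu, forall t, 0 <= t < 1 -> 0 < g (Ginv g t) < a^-1}.
  apply: (ae_Ginv (P := fun x => 0 < g x < a^-1)).
  move: g_pos g_lt; apply: filterS2; first exact: (ae_filter_ringOfSetsType mu).
  by move=> x gx glt x0 Gx; rewrite gx//= glt.
apply: filterS; first exact: (ae_filter_ringOfSetsType mu).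
move=> t gt /andP[t0]; rewrite le_eqVlt => /predU1P[->|t1].
  by rewrite /wfun subrr mulr0.
move/(_ _)/andP: gt => []; first by rewrite t0.
move=> g0 ga; rewrite /wfun mulr_ge0//; last by rewrite subr_ge0 ltW.
rewrite mulr_ge0//; first by rewrite invr_ge0; move: ha => /andP[_ a2]; lra.
rewrite subr_ge0 -[leLHS]invrK lef_pV2 ?posrE ?ltW// invr_gt0.
by case/andP : ha.
Qed.

Lemma integrable_inv_density_Ginv (xi : R) : 0 <= xi < 1 ->
  mu.-integrable `[0, xi] (EFin \o (fun t => (g (Ginv g t))^-1)).
Proof.
move=> /[dup] xi01 /andP[xi0 xi1]; apply/integrableP; split.
  apply/measurable_EFinP.
  have mg := measurableT_comp (measurable_inv R) density_Ginv_meas.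
  apply: measurable_funS mg => //.
  by apply: subset_itvl; rewrite bnd_simp.
rewrite [ltLHS](_ : _ = \int[mu]_(t in `[0%R, xi]) (g (Ginv g t))^-1%:E)%E.
  by rewrite integral_inv_density_Ginv// ltry.
apply: eq_integral => t _ /=.
by rewrite ger0_norm// invr_ge0; exact/g_ge0/Ginv_ge0.
Qed.

(** As [t <= xi < 1], the factor [1 - t] cancels; the term [a * xi] then restores the integral of
    the subtracted constant [a]. *)
Lemma phifunE (xi : R) : 0 <= xi < 1 -> phifun a g xi = Ginv g xi.
Proof.
move=> /[dup] xi01 /andP[xi0 xi1].
rewrite /phifun (_ : fine _ = \int[mu]_(t in `[0, xi])
    ((1 - a / 2)^-1 * ((g (Ginv g t))^-1 - a))); last first.
  congr fine; apply: eq_integral => t; rewrite inE/= in_itv/= => /andP[t0 txi].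
  by rewrite /wfun mulfK// subr_eq0 gt_eqF// (le_lt_trans txi).
have intg := integrable_inv_density_Ginv xi01.
have inta : mu.-integrable `[0, xi] (EFin \o (fun=> a)).
  apply: continuous_compact_integrable; first exact: segment_compact.
  by apply: continuous_subspaceT => x; exact: cst_continuous.
rewrite RintegralZl//; last first.
  exact: integrableB intg inta.
rewrite RintegralB// Rintegral_cst//= lebesgue_measure_itv/= lte_fin sube0.
rewrite [X in fine X](_ : _ = xi%:E); last first.
  by move: xi0; rewrite le_eqVlt => /predU1P[<-|->]; rewrite ?ltxx.
rewrite {1}/Rintegral integral_inv_density_Ginv//= mulrA mulfV// mul1r.
by rewrite subrK.
Qed.

Lemma integral_onem : (\int[mu]_(t in `[0%R, 1%R]) (1 - t)%:E = (2^-1)%:E)%E.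
Proof.
pose F (t : R) : R := t - 2^-1 *: t ^+ 2.
have dF (t : R) : is_derive t 1 F (1 - t).
  by apply: is_derive_eq; rewrite /GRing.scale/=; lra.
rewrite (@continuous_FTC2 _ _ F)//.
- by rewrite /F -EFinB; congr EFin; rewrite /GRing.scale/=; lra.
- by apply: continuous_subspaceT => x; apply: cvgB;
    [exact: cvg_cst|exact: cvg_id].
- have cF : continuous F.
    move=> t; apply/differentiable_continuous/derivable1_diffP.
    by have [] := dF t.
  split; first by move=> t _; have [] := dF t.
    exact/cvg_at_right_filter/cF.
  exact/cvg_at_left_filter/cF.
- by move=> t _; rewrite derive1E; have [_] := dF t.
Qed.

Let onem_integrable : mu.-integrable `[0, 1] (EFin \o (fun t : R => 1 - t)).
Proof.
apply: continuous_compact_integrable; first exact: segment_compact.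
by apply: continuous_subspaceT => x; apply: cvgB;
    [exact: cvg_cst|exact: cvg_id].
Qed.

(** The reciprocal-density term contributes the mean, 1, and the term in [a] contributes [a / 2];
    the prefactor normalizes [1 - a / 2]. *)
Lemma integral_wfun : (\int[mu]_(t in `[0%R, 1%R]) (wfun a g t)%:E = 1)%E.
Proof.
have int1 : (\int[mu]_(t in `[0%R, 1%R])
    ((g (Ginv g t))^-1 * (1 - t))%:E = 1)%E.
  rewrite -g_mean -integral_ccdf.
  (* The positive part of [1 - t] is nonnegative everywhere and zero from 1 on, as the substitution
     requires. *)
  transitivity (\int[mu]_(t in `[0%R, 1%R])
      ((g (Ginv g t))^-1 * Num.max 0 (1 - t))%:E)%E.
    apply: eq_integral => t; rewrite inE/= in_itv/= => /andP[t0 t1].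
    by rewrite max_r// subr_ge0.
  rewrite (integral_div_density_Ginv (h := fun t => Num.max 0 (1 - t)))//.
  - by apply: eq_integral => t _; rewrite max_r// subr_ge0 Gcdf_le1.
  - by apply: measurable_maxr => //; exact: measurable_funB.
  - by move=> t; rewrite le_max lexx.
  - by move=> t t1; rewrite max_l// subr_le0.
pose k t := (g (Ginv g t))^-1 * (1 - t).
have intk : mu.-integrable `[0, 1] (EFin \o k).
  apply/integrableP; split.
    apply/measurable_EFinP/measurable_fun_itv_bndo_bndcP.
    apply: measurable_funM; last exact: measurable_funB.
    exact: (measurableT_comp (measurable_inv R) density_Ginv_meas).
  rewrite [ltLHS](_ : _ = 1)%E ?ltry// -int1; apply: eq_integral => t.
  rewrite inE/= in_itv/= => /andP[t0 t1].
  rewrite ger0_norm// mulr_ge0 ?subr_ge0// invr_ge0; exact/g_ge0/Ginv_ge0.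
transitivity (\int[mu]_(t in `[0%R, 1%R])
    (((1 - a / 2)^-1 * k t)%:E - ((1 - a / 2)^-1 * a * (1 - t))%:E))%E.
  by apply: eq_integral => t _; rewrite -EFinB /wfun /k; congr EFin; ring.
rewrite integralB//; last 2 first.
- exact: (integrableZl _ (1 - a / 2)^-1 intk).
- exact: (integrableZl _ ((1 - a / 2)^-1 * a) onem_integrable).
under eq_integral do rewrite EFinM.
rewrite integralZl// int1 mule1.
under eq_integral do rewrite EFinM.
rewrite integralZl// integral_onem -EFinM -EFinB; congr EFin.
by field; rewrite subr_eq0; case/andP : ha => _ /gt_eqF ->.
Qed.

(** * Differentiation of [G] and of its inverse *)

Lemma ae_is_derive_Gcdf : {ae mu, forall x : R, 0 < x -> is_derive x 1 G (g x)}.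
Proof.
have : {ae mu, forall x, lebesgue_pt f x}.
  by apply/lebesgue_differentiation/open_integrable_locally => //; exact: openT.
apply: filterS; first exact: (ae_filter_ringOfSetsType mu).
move=> x fx x0.
(* At a Lebesgue point the integral has derivative [f x]; the bounds 0 and [x + 1] put [x] in the
   interior. *)
have [] := @FTC1_lebesgue_pt R f (BLeft 0) x (x + 1) _ _ _ fx.
- by rewrite ltrDl.
- exact: integrableS intf.
- by rewrite lte_fin.
rewrite (_ : (fun _ => _) = G); last first.
  by apply/funext => y; rewrite (@Gcdf_itv 0).
move=> dG G'; apply: DeriveDef => //; rewrite -derive1E G'.
by rewrite /f patchE mem_set//= in_itv/= ltW.
Qed.

(** By continuity of [G], the conditions [y > 0] and [G y < 1] persist near [x], so [phi] is a local
    left inverse of [G] and the inverse function rule applies. *)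
Lemma is_derive_phifun (x : R) : 0 < x -> G x < 1 -> g x != 0 ->
  is_derive x 1 G (g x) -> is_derive (G x) 1 (phifun a g) (g x)^-1.
Proof.
move=> x0 Gx1 gx0 dG; apply: is_derive_inverse => //.
  near=> y.
  have y0 : 0 < y by near: y; exact: lt_nbhsr.
  have Gy1 : G y < 1.
    by near: y; exact: (cvgr_lt _ (@Gcdf_continuous x)) Gx1.
  by rewrite phifunE ?Gcdf_ge0// GcdfK// ltW.
by near=> y; exact: Gcdf_continuous.
Unshelve. all: by end_near. Qed.

Lemma phifun_identities : {ae mu, forall x, 0 <= x -> G x < 1 ->
  exists xi, [/\ 0 <= xi < 1, phifun a g xi = x,
    (forall xi', 0 <= xi' < 1 -> phifun a g xi' = x -> xi' = xi) &
    [/\ derivable (phifun a g) xi 1,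
      g x = (derive1 (phifun a g) xi)^-1 &
      a * g x / (1 - a * g x)
        = (2 * a / (2 - a)) * ((1 - xi) / wfun a g xi)]]}.
Proof.
(* The origin is discarded because the derivative of [G] is available only at positive points. *)
have ae0 : {ae mu, forall x : R, x != 0}.
  exists [set 0]; split => //; first exact: lebesgue_measure_set1.
  by move=> x /= /negP/negPn/eqP.
have ae3 : {ae mu, forall x, [/\ (0 <= x -> G x < 1 -> 0 < g x),
    (0 <= x -> g x < a^-1) & x != 0]}.
  move: g_pos g_lt ae0; apply: filterS3.
    exact: (ae_filter_ringOfSetsType mu).
  by move=> x; split.
move: ae3 ae_is_derive_Gcdf; apply: filterS2.
  exact: (ae_filter_ringOfSetsType mu).
move=> x [gx glt x0] dG x_ge0 Gx1.
have {}x0 : 0 < x by rewrite lt_neqAle eq_sym x0.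
have {}gx := gx x_ge0 Gx1; have {}glt := glt x_ge0; have {}dG := dG x0.
have G01 : 0 <= G x < 1 by rewrite Gcdf_ge0.
have [dphi phi'] := is_derive_phifun x0 Gx1 (lt0r_neq0 gx) dG.
(* [phi] coincides with [Ginv g] on [[0, 1[], so [G x] is the only candidate for the preimage of
   [x]. *)
exists (G x); split => //.
- by rewrite phifunE// GcdfK.
- by move=> xi' xi01; rewrite phifunE// => <-; rewrite GinvK.
split => //; first by rewrite derive1E phi' invrK.
have [a0 a2] := andP ha.
(* This keeps both [1 - a * g x] and [w] at [G x] away from zero, so the last identity is one of
   rational functions. *)
have ag : a * g x < 1 by rewrite mulrC -ltr_pdivlMr// div1r.
rewrite /wfun GcdfK//; field.
by apply/and4P; split; rewrite lt0r_neq0//; lra.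
Qed.

End quantile_density.
End cdf_of_density.

Theorem theorem3p6 (R : realType) (a : R) (g : R -> R)
  (ha : 0 < a < 2)
  (g_meas : measurable_fun (`[0, +oo[ : set R) g)
  (g_ge0 : forall x, 0 <= x -> 0 <= g x)
  (g_int1 : ((\int[lebesgue_measure]_(x in `[0%R, +oo[) (g x)%:E)%E = 1%E))
  (g_lt : {ae lebesgue_measure, forall x, 0 <= x -> g x < a^-1})
  (g_mean : ((\int[lebesgue_measure]_(x in `[0%R, +oo[) (x * g x)%:E)%E = 1%E))
  (g_pos : {ae lebesgue_measure, forall x, 0 <= x -> Gcdf g x < 1 -> 0 < g x}) :
  (* w is a probability density on [0,1] *)
  (measurable_fun (`[0, 1] : set R) (wfun a g)
   /\ {ae lebesgue_measure, forall xi, 0 <= xi <= 1 -> 0 <= wfun a g xi}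
   /\ ((\int[lebesgue_measure]_(xi in `[0%R, 1%R]) (wfun a g xi)%:E)%E = 1%E))
  /\
  (* for a.e. x >= 0 in the range of G^{-1} (i.e. G x < 1), phi^{-1}(x) is a
     well-defined xi in [0,1), phi is differentiable there, and the two
     identities hold *)
  {ae lebesgue_measure, forall x, 0 <= x -> Gcdf g x < 1 ->
     exists xi, [/\ 0 <= xi < 1, phifun a g xi = x,
       (forall xi', 0 <= xi' < 1 -> phifun a g xi' = x -> xi' = xi) &
       [/\ derivable (phifun a g) xi 1,
       g x = (derive1 (phifun a g) xi)^-1 &
       a * g x / (1 - a * g x)
         = (2 * a / (2 - a)) * ((1 - xi) / wfun a g xi)]]}.
Proof.
split; last exact: phifun_identities.
by split; [exact: wfun_meas|split; [exact: wfun_ge0|exact: integral_wfun]].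
Qed.
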